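(* Let $\Gamma$ be a primitive strongly regular graph with parameters $(v,k,\lambda,\mu)$, eigenvalues $k > e^+ > 0 > e^-$, and let $m^-$ be the multiplicity of $e^-$. Suppose $ve^- = m^-(e^- - k)$. Let $Y, Z$ be two different Delsarte cocliques of $\Gamma$. For a vertex $z \in Z \setminus Y$ let $b_z = \{ y \in Y : y \sim z \}$. Then: \begin{enumerate} \item[(a)] The set $\mathcal{B} := \{ b_z : z \in Z \setminus Y\}$ is a symmetric $2$-$\left( \frac{(e^+)^2 - (e^-)^{2}}{(e^+)^{2} + e^-}, -e^-, -(e^+)^2 - e^- \right)$ design (on the point set $Y\setminus Z$). \item[(b)] $|Y \cap Z| = m^- - \frac{(e^+)^2 - (e^-)^2}{(e^+)^2 + e^-} = \frac{(e^-+1)e^+}{(e^+)^2 + e^-}$. \item[(c)] For every vertex $w$ of $\Gamma$ with $w \notin Y$ and $w \notin Z$, the set $\{y \in Y : y \sim w\}$ contains exactly $e^+$ elements of $Y \cap Z$. \item[(d)] $\Gamma$ contains at most $m^-+1$ Delsarte cocliques. If $\Gamma$ contains exactly $m^-+1$ Delsarte cocliques, then a symmetric $2$-$\left(\frac{(e^+)^2+ e^+e^-+e^+ - (e^-)^2}{(e^+)^2 + e^-}, \frac{(e^-+1)e^+}{(e^+)^2 + e^-}, \frac{-(e^+)^2 + e^+}{(e^+)^2 + e^-}\right)$ design exists, and every vertex of $\Gamma$ lies in exactly $1+\frac{(e^-+1)e^+}{(e^+)^2 + e^-}$ Delsarte cocliques. \item[(e)] The common intersection of any three distinct Delsarte cocliques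 of $\Gamma$ has size $\frac{-(e^+)^2 + e^+}{(e^+)^2 + e^-}$. \item[(f)] If $e^+$ and $e^-$ are coprime and $e^+ > 1$, then $\Gamma$ contains at most two Delsarte cocliques. \end{enumerate}
   Context: A strongly regular graph with parameters $(v,k,\lambda,\mu)$ has $v$ vertices, is $k$-regular, any two adjacent vertices have exactly $\lambda$ common neighbours and any two distinct non-adjacent vertices have exactly $\mu$ common neighbours. Its adjacency matrix has eigenvalues $k$, $e^+$, $e^-$ with $k \ge e^+ \ge 0 > e^-$; $m^-$ denotes the multiplicity of $e^-$. It is primitive if both it and its complement are connected. $u \sim w$ means $u$ and $w$ are adjacent. A coclique is a set of pairwise non-adjacent vertices; a Delsarte coclique is a coclique of size $\frac{ve^-}{e^- - k}$. A $2$-$(\tilde v,\tilde k,\tilde\lambda)$ design is a set $\mathcal{B}$ of $\tilde k$-subsets (blocks) of a $\tilde v$-element point set such that every pair of distinct points lies in exactly $\tilde\lambda$ blocks; it is symmetric if any two distinct blocks meet in the same number of points (equivalently, for a $2$-design with at least two blocks, the number of blocks equals $\tilde v$). *)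

(* Defs.v *)
From HB Require Import structures.
From mathcomp Require Import all_boot all_order all_algebra.
Set Implicit Arguments. Unset Strict Implicit. Unset Printing Implicit Defensive.
Import Order.TTheory GRing.Theory Num.Theory.
Local Open Scope ring_scope.

Definition simple_graph (V : finType) (adj : rel V) : Prop :=
  (forall x y, adj x y = adj y x) /\ (forall x, ~~ adj x x).

Definition srg (V : finType) (adj : rel V) (v k lam mu : nat) : Prop :=
  [/\ simple_graph adj, (#|V| = v)%N,
      forall x, (#|[set y | adj x y]| = k)%N,
      forall x y, adj x y -> (#|[set z | adj x z && adj y z]| = lam)%N
    & forall x y, x != y -> ~~ adj x y -> (#|[set z | adj x z && adj y z]| = mu)%N].

Definition compl_rel (V : finType) (adj : rel V) : rel V :=
  fun x y => (x != y) && ~~ adj x y.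

Definition connected_graph (V : finType) (adj : rel V) : Prop :=
  forall x y, connect adj x y.

Definition primitive (V : finType) (adj : rel V) : Prop :=
  connected_graph adj /\ connected_graph (compl_rel adj).

Definition adjmx (R : nzRingType) (V : finType) (adj : rel V) : 'M[R]_#|V| :=
  \matrix_(i < #|V|, j < #|V|) (adj (enum_val i) (enum_val j))%:R.

Definition coclique (V : finType) (adj : rel V) (Y : {set V}) : bool :=
  [forall x in Y, forall y in Y, ~~ adj x y].

Definition delsarte (R : fieldType) (V : finType) (adj : rel V)
  (k : nat) (em : R) (Y : {set V}) : bool :=
  coclique adj Y && (#|Y|%:R == #|V|%:R * em / (em - k%:R)).

Definition design2 (T : finType) (P : {set T}) (B : {set {set T}})
  (vt kt lt : nat) : Prop :=
  [/\ (#|P| = vt)%N,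
      forall b, b \in B -> b \subset P /\ (#|b| = kt)%N
    & forall x y, x \in P -> y \in P -> x != y ->
        (#|[set b in B | (x \in b) && (y \in b)]| = lt)%N].

Definition sym_design2 (T : finType) (P : {set T}) (B : {set {set T}})
  (vt kt lt : nat) : Prop :=
  design2 P B vt kt lt /\
  exists c : nat, forall b1 b2, b1 \in B -> b2 \in B -> b1 != b2 ->
     (#|b1 :&: b2| = c)%N.

(* Main.v *)
Require Import Defs.
From HB Require Import structures.
From mathcomp Require Import all_boot all_order all_algebra ring lra.
Import Order.TTheory GRing.Theory Num.Theory.
Local Open Scope ring_scope.

(** Write r = e^+, q = -e^- and m = m^-.  Besides the standard relations between
    the eigenvalues and v, k, lambda, mu, the hypothesis v e^- = m (e^- - k) yields
    k (1 + r) = q (q + r) and expresses all parameters through q and r; Delsarte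
    cocliques then have size m.  Two sums of squares over the vertices outside a
    Delsarte coclique Y vanish.  The first says that every such vertex has exactly
    q neighbours in Y, the second (which uses |Y| = m, that is, that the projections of Y span the
    e^- eigenspace) that two such vertices have q - r^2 - r or q - r^2 common
    neighbours in Y, according to whether they are adjacent or not.
    Double counting edges gives (a), (b), (c) and (e).  For (d), the traces
    Y :&: Y' of the other Delsarte cocliques on a fixed Y form a system of sets of
    constant size and constant pairwise intersection, so Fisher's inequality bounds
    their number by m, and equality gives a symmetric design; counting incidences
    then shows that the cocliques cover all vertices.  For (f), integrality of (e)
    makes q - r^2 divide r - 1, which contradicts lambda >= 0. *)

(** * Systems of sets with constant pairwise intersections *)

Lemma sum_indicator {R : pzSemiRingType} (T : finType) (A : {set T}) (P : pred T) :
  \sum_(x in A) (P x)%:R = #|[set x in A | P x]|%:R :> R.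
Proof.
rewrite -sum1_card natr_sum big_mkcond [RHS]big_mkcond /=.
by apply: eq_bigr => x _; rewrite inE; case: (x \in A); case: (P x).
Qed.

(** If [u *m M = 0], the quadratic form of [M *m M^T] at [u] vanishes. It equals [a] times the sum
    of the squares of the entries of [u] plus [c] times the square of their sum, and both terms are
    nonnegative. *)
Lemma gram_row_free {F : realFieldType} b n (M : 'M[F]_(b, n)) a c :
  0 < a -> 0 <= c -> M *m M^T = a%:M + const_mx c -> row_free M.
Proof.
move=> a0 c0 MM; rewrite -kermx_eq0; apply/rowV0P => u /sub_kermxP uM.
pose s := \sum_j u 0 j.
have : (u *m (M *m M^T) *m u^T) 0 0 = a * (\sum_j u 0 j ^+ 2) + c * s ^+ 2.
  rewrite MM mulmxDr mulmxDl mul_mx_scalar -scalemxAl !mxE; congr (a * _ + _).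
    by apply: eq_bigr => j _; rewrite !mxE expr2.
  transitivity (\sum_j (c * s) * u 0 j); last by rewrite -mulr_sumr -/s -mulrA.
  apply: eq_bigr => j _; rewrite !mxE; congr (_ * _).
  by rewrite mulrC /s mulr_suml; apply: eq_bigr => l _; rewrite mxE.
have pos j : true -> 0 <= u 0 j ^+ 2 by rewrite sqr_ge0.
rewrite mulmxA uM !mul0mx mxE => /esym/eqP.
have u2_ge0 : 0 <= a * (\sum_j u 0 j ^+ 2) by apply: mulr_ge0 (ltW a0) (sumr_ge0 _ pos).
have s2_ge0 : 0 <= c * s ^+ 2 by rewrite mulr_ge0 ?sqr_ge0.
rewrite paddr_eq0 // => /andP[+ _]; rewrite mulf_eq0 gt_eqF //=.
move=> /eqP/(psumr_eq0P pos) u0; apply/rowP => j; rewrite mxE.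
by apply/eqP; rewrite -sqrf_eq0 u0.
Qed.

(** Ryser's argument: [M] is invertible, so the Gram equation gives
    [M^T = a *: invmx M + (c / K) *: J]. Multiplying by [M] on the right leaves only [J *m M] to be
    found, that is, the column sums of [M]. *)
Lemma gram_square_tr {F : realFieldType} b n (M : 'M[F]_(b, n)) a c K :
  b = n -> (0 < n)%N -> 0 < a -> 0 <= c -> K != 0 ->
  M *m M^T = a%:M + const_mx c -> M *m (const_mx 1 : 'M_n) = const_mx K ->
  M^T *m M = a%:M + const_mx c.
Proof.
move=> eb; subst b => n0 a0 c0 K0 MM; pose J : 'M[F]_n := const_mx 1.
have constJ (d : F) : const_mx d = d *: J by apply/matrixP => i j; rewrite !mxE mulr1.
rewrite -/J => MJ; rewrite !constJ in MM MJ *.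
have Mu : M \in unitmx by rewrite -row_free_unit (gram_row_free _ _ _ a c) // constJ.
have JJ : J *m J = n%:R *: J.
  apply/matrixP => i j; rewrite !mxE mulr1 (eq_bigr (fun=> 1)) ?sumr_const ?card_ord //.
  by move=> l _; rewrite !mxE mulr1.
have VJ : invmx M *m J = K^-1 *: J.
  by rewrite -[J in RHS](mulKmx Mu) MJ -scalemxAr scalerA mulVf // scale1r.
have MT : M^T = a *: invmx M + (c / K) *: J.
  rewrite -[LHS](mulKmx Mu) MM mulmxDr mul_mx_scalar -scalemxAr VJ scalerA.
  by [].
pose K' := (a + c * n%:R) / K.
have JM : J *m M = K' *: J.
  apply: trmx_inj; rewrite trmx_mul linearZ /= trmx_const -/J MT mulmxDl.
  rewrite -!scalemxAl VJ JJ !scalerA -scalerDl; congr (_ *: _).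
  by rewrite /K' mulrDl mulrAC.
(* The columns have constant sum [K'] and the rows constant sum [K]; computing [J *m M *m J] in two
   ways identifies them, as [n] is nonzero. *)
have KK : K' = K.
  have : (K' * n%:R) *: J = (K * n%:R) *: J.
    by rewrite -[LHS]scalerA -JJ scalemxAl -JM -mulmxA MJ -scalemxAr JJ scalerA.
  move/matrixP/(_ (Ordinal n0) (Ordinal n0)); rewrite !mxE !mulr1 => /mulIf; apply.
  by rewrite pnatr_eq0 -lt0n.
by rewrite MT mulmxDl -!scalemxAl mulVmx // JM KK scalerA divfK // scalemx1.
Qed.

Section Fisher.
Context {T : finType} {D : {set T}} {C : {set {set T}}} {i x : nat}.
Hypotheses (lt_x_i : (x < i)%N)
  (blockC : forall X, X \in C -> X \subset D /\ #|X| = i)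
  (meetC : {in C &, forall X X', X != X' -> #|X :&: X'| = x}).

Let M : 'M[rat]_(#|C|, #|D|) :=
  \matrix_(a < #|C|, b < #|D|) (enum_val b \in enum_val a)%:R.

Let meetD X (P : pred T) : X \in C -> #|[set p in D | (p \in X) && P p]| = #|[set p in X | P p]|.
Proof.
move=> /blockC[/subsetP XD _]; apply: eq_card => p; rewrite !inE.
by case: (boolP (p \in X)) => [/XD->//|_]; rewrite andbF.
Qed.

Let gramM : M *m M^T = (i%:R - x%:R)%:M + const_mx x%:R.
Proof.
apply/matrixP => a b; rewrite !mxE.
pose F p : rat := ((p \in enum_val a) && (p \in enum_val b))%:R.
transitivity (\sum_(j < #|D|) F (enum_val j)).
  by apply: eq_bigr => j _; rewrite !mxE /F -natrM mulnb.
rewrite -(big_enum_val (A := mem D) F) /= sum_indicator meetD ?enum_valP //.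
have [<-|ne] := eqVneq a b.
  have -> : [set p in enum_val a | p \in enum_val a] = enum_val a.
    by apply/setP => p; rewrite inE andbb.
  by have [_ ->] := blockC _ (enum_valP a); rewrite subrK.
by rewrite add0r -(meetC _ _ (enum_valP a) (enum_valP b)) ?(inj_eq enum_val_inj).
Qed.

Let ix_gt0 : 0 < i%:R - x%:R :> rat. Proof. by rewrite subr_gt0 ltr_nat. Qed.

(** The rows of the incidence matrix [M] are independent by [gramM], so there are at most as many
    rows as columns. *)
Lemma fisher : (#|C| <= #|D|)%N.
Proof.
have := gram_row_free _ _ _ _ _ ix_gt0 (ler0n _ x) gramM.
by rewrite -row_leq_rank => /leq_trans; apply; apply: rank_leq_col.
Qed.

(** For square [M] the Gram relation passes from rows to columns, and the entries of [M^T *m M]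
    count the sets through two given points. *)
Lemma square_system_dual : #|C| = #|D| -> {in D &, forall p p',
  #|[set X in C | (p \in X) && (p' \in X)]| = if p == p' then i else x}.
Proof.
move=> CD p p' pD p'D.
have D0 : (0 < #|D|)%N by apply/card_gt0P; exists p.
have i0 : i%:R != 0 :> rat by rewrite pnatr_eq0 -lt0n (leq_trans _ lt_x_i).
have MJ : M *m (const_mx 1 : 'M_#|D|) = const_mx i%:R.
  apply/matrixP => a b; rewrite !mxE.
  pose F p : rat := (p \in enum_val a)%:R.
  transitivity (\sum_(j < #|D|) F (enum_val j)).
    by apply: eq_bigr => j _; rewrite !mxE mulr1.
  rewrite -(big_enum_val (A := mem D) F) /= sum_indicator.
  have [/subsetP aD <-] := blockC _ (enum_valP a).
  by congr (_%:R); apply: eq_card => y; rewrite !inE andb_idl // => /aD.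
have := gram_square_tr _ _ _ _ _ _ CD D0 ix_gt0 (ler0n _ x) i0 gramM MJ.
move/matrixP/(_ (enum_rank_in pD p) (enum_rank_in pD p')); rewrite !mxE.
pose F (X : {set T}) : rat := ((p \in X) && (p' \in X))%:R.
rewrite (eq_bigr (fun j => F (enum_val j))); last first.
  by move=> j _; rewrite !mxE /F !enum_rankK_in // -natrM mulnb.
rewrite -(big_enum_val (A := mem C) F) /= sum_indicator => /eqP.
have -> : (enum_rank_in pD p == enum_rank_in pD p') = (p == p').
  by rewrite -(inj_eq enum_val_inj) !enum_rankK_in.
by rewrite mulrb; case: (p =P p') => _; rewrite ?subrK ?add0r eqr_nat => /eqP.
Qed.

End Fisher.

(** Blocks lie inside [P], so pulling them back along the enumeration of [P] is injective and
    preserves all cardinalities. This provides the abstract point set required in (d). *)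
Lemma sym_design2_ord (T : finType) (P : {set T}) (B : {set {set T}}) vt kt lt :
  sym_design2 P B vt kt lt ->
  exists (n : nat) (B' : {set {set 'I_n}}), sym_design2 [set: 'I_n] B' vt kt lt.
Proof.
case=> -[cP bB pB] [c cB]; exists #|P|.
pose f : 'I_#|P| -> T := enum_val; pose g (X : {set T}) := f @^-1: X.
have cg (X : {set T}) : X \subset P -> #|g X| = #|X|.
  move=> /subsetP XP; rewrite -(card_imset _ enum_val_inj); apply: eq_card => p.
  apply/imsetP/idP => [[j]|pX]; first by rewrite inE => ? ->.
  by exists (enum_rank_in (XP p pX) p); rewrite ?inE /f enum_rankK_in // XP.
have ginj : {in B &, injective g}.
  move=> X X' XB X'B /setP e; apply/setP => p.
  have [pP|pP] := boolP (p \in P).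
    by have := e (enum_rank_in pP p); rewrite !inE /f enum_rankK_in.
  have out (Z : {set T}) : Z \in B -> p \in Z = false.
    by move=> /bB[/subsetP ZP _]; apply: contraNF pP => /ZP.
  by rewrite !out.
exists (g @: B); split; first split.
- by rewrite cardsT card_ord.
- by move=> b /imsetP[X /bB[XP kX] ->]; rewrite cg ?subsetT.
- move=> j j' _ _ ne; rewrite -(pB (f j) (f j')) ?enum_valP ?(inj_eq enum_val_inj) //.
  rewrite -(card_in_imset (f := g) (D := [set b in B | (f j \in b) && (f j' \in b)])).
    apply: eq_card => b; rewrite inE; apply/andP/imsetP.
      by case=> /imsetP[X XB ->]; rewrite !inE => jX; exists X => //; rewrite inE XB.
    by case=> X; rewrite inE => /andP[XB jX] ->; rewrite !inE imset_f.
  by move=> X X'; rewrite !inE => /andP[XB _] /andP[X'B _]; apply: ginj.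
exists c => b1 b2 /imsetP[X XB ->] /imsetP[X' X'B ->] ne.
rewrite -(cB X X') //; last by apply: contraNneq ne => ->.
rewrite -preimsetI; apply: cg; have [XP _] := bB X XB.
exact: subset_trans (subsetIl _ _) XP.
Qed.

(** * Strongly regular graphs and their spectrum *)

Section Counting.
Context {R : realFieldType} {V : finType} {adj : rel V} {v k lam mu : nat}.
Hypothesis G : srg adj v k lam mu.
Local Notation a x y := ((adj x y)%:R : R).

Lemma adj_sym : symmetric adj. Proof. by case: G => -[]. Qed.

Lemma adj_irr x : adj x x = false.
Proof. by case: G => -[_ /(_ x)/negbTE]. Qed.

Lemma sum_adj x : \sum_y a x y = k%:R.
Proof.
case: G => _ _ /(_ x) <- _ _.
rewrite -sum1_card natr_sum [RHS]big_mkcond /=.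
by apply: eq_bigr => y _; rewrite inE; case: adj.
Qed.

Lemma sum_adj2 x y :
  \sum_z a x z * a y z =
  (k%:R - mu%:R) * (x == y)%:R + (lam%:R - mu%:R) * a x y + mu%:R.
Proof.
transitivity (#|[set z | adj x z && adj y z]|%:R : R).
  rewrite -sum1_card natr_sum [RHS]big_mkcond /=.
  by apply: eq_bigr => z _; rewrite inE; case: adj; case: adj; rewrite ?mulr0 ?mulr1.
case: G => _ _ hk hl hm; case: (eqVneq x y) => [<-|ne].
  have -> : [set z | adj x z && adj x z] = [set z | adj x z].
    by apply/setP => z; rewrite !inE andbb.
  by rewrite hk adj_irr /=; ring.
case e: (adj x y); first by rewrite (hl _ _ e) /=; ring.
by rewrite (hm _ _ ne) ?e //=; ring.
Qed.

(** Both sides count the walks of length two starting at [x]. *)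
Lemma srg_count (x : V) :
  k%:R ^+ 2 = (k%:R - mu%:R) + (lam%:R - mu%:R) * k%:R + mu%:R * v%:R :> R.
Proof.
transitivity (\sum_y \sum_z a x z * a y z).
  rewrite exchange_big expr2 -{1}(sum_adj x) mulr_suml.
  apply: eq_bigr => z _; rewrite /= -mulr_sumr -(sum_adj z); congr (_ * _).
  by apply: eq_bigr => y _; rewrite adj_sym.
under eq_bigr => y _ do rewrite sum_adj2.
rewrite !big_split /= -!mulr_sumr sum_adj sumr_const.
rewrite (bigD1 x) //= eqxx big1 ?addr0 ?mulr1; last first.
  by move=> y ne; rewrite eq_sym (negbTE ne).
have <- : #|V| = v by case: G.
by rewrite !mulr_natr.
Qed.

End Counting.

(** In a full-rank factorization [P = C *m B], idempotency and cancellation give [B *m C = 1], an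
    identity matrix of size [\rank P]; the trace is invariant under exchanging the factors. *)
Lemma idempotent_rank {R : numFieldType} n (P : 'M[R]_n) : P *m P = P -> (\rank P)%:R = \tr P.
Proof.
move=> PP; have := mulmx_base P; set C := col_base P; set B := row_base P => CB.
have BC : B *m C = 1%:M.
  have e : C *m (B *m C) *m B = C *m 1%:M *m B.
    by rewrite mulmx1 -mulmxA -mulmxA CB mulmxA CB PP.
  apply: (row_full_inj (col_base_full P)); exact: (row_free_inj (row_base_free P)).
by rewrite -[in RHS]CB mxtrace_mulC BC mxtrace1.
Qed.

Section Spectrum.
Context {R : rcfType} {V : finType} {adj : rel V} {v k lam mu : nat}.
Hypothesis G : srg adj v k lam mu.
Local Notation A := (adjmx R adj).
Local Notation J := (const_mx 1 : 'M[R]_#|V|).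

Lemma adjmx_mulJ : A *m J = k%:R *: J.
Proof.
apply/matrixP => i j; rewrite !mxE mulr1 -(sum_adj G (enum_val i)).
rewrite (eq_bigr (fun l => (adj (enum_val i) (enum_val l))%:R)).
  by rewrite -(big_enum_val (A := V) (fun z => (adj (enum_val i) z)%:R)).
by move=> l _; rewrite !mxE mulr1.
Qed.

Lemma tr_adjmx : A^T = A.
Proof. by apply/matrixP => i j; rewrite !mxE (adj_sym G). Qed.

Lemma Jmul_adjmx : J *m A = k%:R *: J.
Proof. by apply: trmx_inj; rewrite trmx_mul linearZ /= !trmx_const tr_adjmx adjmx_mulJ. Qed.

Lemma mulJJ : J *m J = v%:R *: J.
Proof.
apply/matrixP => i j; rewrite !mxE mulr1.
rewrite (eq_bigr (fun=> 1)); last by move=> l _; rewrite !mxE mulr1.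
have <- : #|V| = v by case: G.
by rewrite sumr_const card_ord.
Qed.

Lemma adjmx_sqr :
  A *m A = (k%:R - mu%:R)%:M + (lam%:R - mu%:R) *: A + mu%:R *: J.
Proof.
apply/matrixP => i j; rewrite !mxE.
rewrite (eq_bigr (fun l => (adj (enum_val i) (enum_val l))%:R *
                           (adj (enum_val j) (enum_val l))%:R)).
  rewrite -(big_enum_val (A := V) (fun z => (adj (enum_val i) z)%:R * (adj (enum_val j) z)%:R)) /=.
  by rewrite (sum_adj2 G) (inj_eq enum_val_inj) mulr_natr mulr1.
by move=> l _; rewrite !mxE (adj_sym G (enum_val l)).
Qed.

(** Evaluating [u *m A *m J] in two ways gives [x *: (u *m J) = k%:R *: (u *m J)]. *)
Lemma eigenvector_mulJ x (u : 'rV_#|V|) :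
  u *m A = x *: u -> x != k%:R -> u *m J = 0.
Proof.
move=> ux ne; have : (k%:R - x) *: (u *m J) = 0.
  rewrite scalerBl [x *: _]scalemxAl -ux -mulmxA adjmx_mulJ -scalemxAr.
  by rewrite subrr.
by move/eqP; rewrite scaler_eq0 subr_eq0 eq_sym (negbTE ne) => /eqP.
Qed.

Lemma eigenvalue_quadratic x : eigenvalue A x -> x != k%:R ->
  x ^+ 2 = (k%:R - mu%:R) + (lam%:R - mu%:R) * x.
Proof.
move=> /eigenvalueP[u ux u0] ne; apply/eqP; rewrite -subr_eq0.
have : (x ^+ 2 - ((k%:R - mu%:R) + (lam%:R - mu%:R) * x)) *: u = 0.
  apply/eqP; rewrite scalerBl subr_eq0; apply/eqP.
  rewrite expr2 -scalerA -ux scalemxAl -ux -mulmxA adjmx_sqr !mulmxDr.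
  rewrite -!scalemxAr (eigenvector_mulJ _ _ ux ne) scaler0 addr0 ux mul_mx_scalar.
  by rewrite scalerA [RHS]scalerDl.
by move/eqP; rewrite scaler_eq0 (negbTE u0) orbF.
Qed.

Context {ep em : R}.
Hypothesis spec : forall x : R, eigenvalue A x = [|| x == k%:R, x == ep | x == em].
Hypotheses (lt_ep_k : ep < k%:R) (ep_gt0 : 0 < ep) (em_lt0 : em < 0).

Lemma srg_inhabited : (0 < #|V|)%N.
Proof.
have : eigenvalue A ep by rewrite spec eqxx orbT.
rewrite lt0n; case/eigenvalueP => u _; apply: contraNneq => V0.
by apply/eqP/matrixP => i j; have := ltn_ord j; rewrite {2}V0.
Qed.

(** [ep] and [em] are distinct roots of the quadratic of [eigenvalue_quadratic], so Vieta's formulas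
    give the first two equations; the third then restates [srg_count]. *)
Lemma srg_params :
  [/\ lam%:R - mu%:R = ep + em, mu%:R = k%:R + ep * em &
      (k%:R - ep) * (k%:R - em) = v%:R * mu%:R].
Proof.
have hp : eigenvalue A ep by rewrite spec eqxx orbT.
have hm : eigenvalue A em by rewrite spec eqxx !orbT.
have k0 : (0 : R) <= k%:R by [].
have ep_k : ep != k%:R by rewrite lt_eqF.
have em_k : em != k%:R by apply/eqP => e; move: em_lt0; rewrite e ltNge k0.
have {hp}ep2 := eigenvalue_quadratic _ hp ep_k.
have {hm}em2 := eigenvalue_quadratic _ hm em_k.
have /card_gt0P[x _] := srg_inhabited; have cnt := @srg_count R _ _ _ _ _ _ G x.
have hs : lam%:R - mu%:R = ep + em.
  have : (lam%:R - mu%:R - (ep + em)) * (ep - em) = 0.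
    have : (lam%:R - mu%:R) * (ep - em) = ep ^+ 2 - em ^+ 2 by rewrite ep2 em2; ring.
    by move=> e; rewrite mulrBl e; ring.
  move/eqP; rewrite mulf_eq0 !subr_eq0 => /orP[/eqP//|/eqP e]; by move: em_lt0; rewrite -e ltNge ltW.
have hp : mu%:R = k%:R + ep * em by rewrite hs in ep2; lra.
split=> //; rewrite hs in cnt; lra.
Qed.

(** The projection onto the eigenspace is an explicit polynomial in [A] and [J]; being idempotent,
    it has rank equal to its trace, and [A] has trace 0. *)
Lemma rank_eigenspace :
  (\rank (eigenspace A em))%:R * (ep - em) = k%:R + ep * (v%:R - 1).
Proof.
have [hs hp hv] := srg_params.
have k0 : (0 : R) <= k%:R by [].
have em_k : em != k%:R by apply/eqP => e; move: em_lt0; rewrite e ltNge k0.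
have V_v : #|V| = v by case: G.
have v0 : v%:R != 0 :> R by rewrite -V_v pnatr_eq0 -lt0n srg_inhabited.
have d0 : ep - em != 0 by rewrite subr_eq0 gt_eqF ?(lt_trans em_lt0).
(* This value makes the row sums of [F] vanish. By [hv] it also equals [mu%:R / (k%:R - em)], which
   is what [F *m A = em *: F] requires. *)
pose t := (k%:R - ep) / v%:R.
have ht : mu%:R = t * (k%:R - em) by rewrite /t mulrAC hv mulrAC mulfV ?mul1r.
have rs : k%:R - mu%:R = - (ep * em) by rewrite hp; ring.
pose F := ep%:M - A + t *: J.
have FA : F *m A = em *: F.
  rewrite /F !mulmxDl mulNmx mul_scalar_mx adjmx_sqr -scalemxAl Jmul_adjmx.
  apply/matrixP => i j; rewrite !mxE hs rs ht.
  by rewrite -(mulr_natr (- _)) -(mulr_natr ep); ring.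
pose P := (ep - em)^-1 *: F.
have eigP : (eigenspace A em :=: P)%MS.
  apply/eqmxP/andP; split; last first.
    by apply/eigenspaceP; rewrite /P -scalemxAl FA !scalerA mulrC.
  apply/rV_subP => u /eigenspaceP ux.
  suff -> : u = u *m P by apply: submxMl.
  rewrite /P -scalemxAr /F !mulmxDr mulmxN ux mul_mx_scalar -scalemxAr.
  rewrite (eigenvector_mulJ _ _ ux em_k) scaler0 addr0 -scalerBl scalerA mulVf ?scale1r //.
have PP : P *m P = P.
  have eP : P *m A = em *: P by rewrite /P -scalemxAl FA !scalerA mulrC.
  rewrite {2}/P -scalemxAr /F !mulmxDr mulmxN eP mul_mx_scalar -scalemxAr.
  have -> : P *m J = 0.
    rewrite /P -scalemxAl /F !mulmxDl mulNmx mul_scalar_mx adjmx_mulJ -scalemxAl mulJJ.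
    by rewrite scalerA divfK // -scalerBl -scalerDl addrC subrKA subrr scale0r scaler0.
  by rewrite scaler0 addr0 -scalerBl scalerA mulVf ?scale1r.
rewrite eigP idempotent_rank // /P /F linearZ /= !raddfD raddfN /= linearZ /=.
have -> : \tr A = 0 by rewrite /mxtrace big1 // => i _; rewrite mxE (adj_irr G).
have -> : \tr J = v%:R.
  by rewrite /mxtrace (eq_bigr (fun=> 1)) ?sumr_const ?card_ord ?V_v // => i _; rewrite mxE.
by rewrite mxtrace_scalar V_v /t; field; rewrite v0.
Qed.

End Spectrum.

(** * Delsarte cocliques *)

Lemma double_count_const {R : pzRingType} (T : finType) (S : {set T}) (f : T -> T -> R) (c d : R) :
  {in S &, forall x y, f x y = c * (x == y)%:R + d} ->
  \sum_(x in S) \sum_(y in S) f x y = c * #|S|%:R + d * #|S|%:R ^+ 2.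
Proof.
move=> fE; transitivity (\sum_(x in S) (c + d * #|S|%:R)); last first.
  by rewrite sumr_const -[LHS]mulr_natr mulrDl expr2 mulrA.
apply: eq_bigr => x xS; rewrite (eq_bigr _ (fun y => fE x y xS)) big_split /=.
rewrite sumr_const -[X in _ + X = _]mulr_natr; congr (_ + _); rewrite -mulr_sumr (bigD1 x) //= eqxx.
by rewrite big1 ?addr0 ?mulr1 // => y /andP[_ ne]; rewrite eq_sym (negbTE ne).
Qed.

Section Delsarte.
Set Implicit Arguments.
Unset Strict Implicit.
Context {R : realFieldType} {V : finType} {adj : rel V} {v k lam mu m : nat} {r q : R}.
Hypothesis G : srg adj v k lam mu.
Hypotheses (r_gt0 : 0 < r) (q_gt1 : 1 < q) (c_gt0 : 0 < q - r ^+ 2).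
Hypotheses (k_def : k%:R = q * (q + r) / (1 + r))
  (mu_def : mu%:R = q * (q - r ^+ 2) / (1 + r))
  (lam_def : lam%:R = q * (q - r ^+ 2) / (1 + r) + r - q)
  (m_def : m%:R = (q ^+ 2 + q * r - r - r ^+ 2) / (q - r ^+ 2))
  (v_def : v%:R = m%:R * (q + 2 * r + 1) / (1 + r)).
Local Notation a x y := ((adj x y)%:R : R).
Local Notation deg S x := (\sum_(y in S) a y x).

(** Under [v%:R * em = m%:R * (em - k%:R)], the Delsarte bound is [m], so these are the Delsarte
    cocliques. *)
Definition maxcoclique (Y : {set V}) := coclique adj Y && (#|Y| == m).
Local Notation mc := maxcoclique.

Let r1_neq0 : 1 + r != 0. Proof. by rewrite gt_eqF // addr_gt0. Qed.
Let c_neq0 : q - r ^+ 2 != 0. Proof. by rewrite gt_eqF. Qed.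

Lemma coclique_adj Y x y : mc Y -> x \in Y -> y \in Y -> adj x y = false.
Proof. by move=> /andP[/forall_inP cY _] xY yY; apply/negbTE/(forall_inP (cY x xY)). Qed.

Lemma card_mc Y : mc Y -> #|Y| = m. Proof. by case/andP => _ /eqP. Qed.

Lemma deg_in Y (S : {set V}) x : mc Y -> S \subset Y -> x \in Y -> deg S x = 0.
Proof.
move=> cY SY xY; rewrite big1 // => y yS.
by rewrite (coclique_adj cY) // (subsetP SY).
Qed.

Lemma sum_outside Y y (F : V -> R) : mc Y -> y \in Y ->
  \sum_(z | z \notin Y) a y z * F z = \sum_z a y z * F z.
Proof.
move=> cY yY; rewrite [RHS](bigID (mem Y)) /= [X in _ = X + _]big1 ?add0r //.
by move=> z zY; rewrite (coclique_adj cY) // mul0r.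
Qed.

Lemma sum_deg Y (S : {set V}) : mc Y -> S \subset Y ->
  \sum_(z | z \notin Y) deg S z = k%:R * #|S|%:R.
Proof.
move=> cY SY; rewrite exchange_big /= mulr_natr -sumr_const; apply: eq_bigr => y yS.
rewrite -(sum_adj G y) -(eq_bigr _ (fun z _ => mulr1 _)) (sum_outside _ cY) //.
  by apply: eq_bigr => z _; rewrite mulr1.
exact: (subsetP SY).
Qed.

(** Counts paths of length two with both ends in [S]. Their midpoints lie outside [Y], and distinct
    ends are non-adjacent, hence have [mu] common neighbours. *)
Lemma sum_deg2 Y (S : {set V}) : mc Y -> S \subset Y ->
  \sum_(z | z \notin Y) deg S z ^+ 2 =
  (k%:R - mu%:R) * #|S|%:R + mu%:R * #|S|%:R ^+ 2.
Proof.
move=> cY SY.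
rewrite -(@double_count_const _ _ _ (fun x y => \sum_z a x z * a y z)); last first.
  move=> x y xS yS; rewrite (sum_adj2 G) (coclique_adj cY) ?mulr0 ?addr0 //;
  exact: (subsetP SY).
under eq_bigr => z _ do rewrite expr2 mulr_suml.
rewrite exchange_big /=; apply: eq_bigr => x xS.
under eq_bigr => z _ do rewrite mulr_sumr.
rewrite exchange_big /=; apply: eq_bigr => y yS.
by rewrite (sum_outside _ cY) // (subsetP SY).
Qed.

Lemma card_outside (Y : {set V}) : mc Y -> \sum_(z | z \notin Y) 1 = v%:R - m%:R :> R.
Proof.
move=> cY; have e : #|V| = v by case: G.
rewrite sumr_const -(card_mc cY) -e -(cardC Y) natrD addrC addKr.
by congr (_%:R); apply: eq_card.
Qed.

(* Equality in the Hoffman bound: the variance of the degrees into Y vanishes. *)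
Lemma deg_out Y x : mc Y -> x \notin Y -> deg Y x = q.
Proof.
move=> cY xY.
have /psumr_eq0P : forall z, z \notin Y -> 0 <= (deg Y z - q) ^+ 2.
  by move=> z _; apply: sqr_ge0.
move=> H; apply/eqP; rewrite -subr_eq0 -sqrf_eq0; apply/eqP; apply: H xY.
transitivity (\sum_(z | z \notin Y) (deg Y z ^+ 2 - 2 * q * deg Y z + q ^+ 2 * 1)).
  by apply: eq_bigr => z _; ring.
rewrite !big_split /= sumrN -!mulr_sumr (sum_deg2 cY) // (sum_deg cY) //.
rewrite (card_outside cY) (card_mc cY) v_def k_def mu_def m_def.
by field; rewrite c_neq0.
Qed.

(** For [x] in another coclique this is the block [b_x] of the theorem. *)
Definition nbrs (Y : {set V}) x := [set y in Y | adj y x].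

Lemma card_nbrs (Y : {set V}) x : #|nbrs Y x|%:R = deg Y x.
Proof. by rewrite -sum_indicator. Qed.

Lemma nbrs_sub (Y : {set V}) x : nbrs Y x \subset Y.
Proof. by apply/subsetP => y; rewrite inE => /andP[]. Qed.

(* For fixed w, the squares of the differences of the two sides, summed over all z
   outside Y, add up to 0. *)
Lemma deg_nbrs Y w z : mc Y -> w \notin Y -> z \notin Y ->
  deg (nbrs Y w) z = q - r ^+ 2 + r ^+ 2 * (w == z)%:R - r * a w z.
Proof.
move=> cY wY zY; have bY := nbrs_sub Y w.
have bq : #|nbrs Y w|%:R = q by rewrite card_nbrs deg_out.
have Nw : deg (nbrs Y w) w = q.
  rewrite -bq -sumr_const; apply: eq_bigr => y; rewrite inE => /andP[_ ->] //.
case: (eqVneq w z) => [<-|ne]; first by rewrite Nw (adj_irr G) /=; ring.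
pose h u := q - r ^+ 2 - r * a w u - deg (nbrs Y w) u.
suff : h z = 0 by rewrite /h => /eqP; rewrite subr_eq0 => /eqP <-; rewrite mulr0 addr0.
have pos u : (u \notin Y) && (u != w) -> 0 <= h u ^+ 2 by rewrite sqr_ge0.
apply/eqP; rewrite -sqrf_eq0; apply/eqP.
apply: (psumr_eq0P pos); last by rewrite zY eq_sym.
(* [h] omits the term of the claim supported at [w], so [u = w] alone contributes [(r ^+ 2) ^+ 2];
   if this is the whole sum, all other squares vanish. *)
suff : \sum_(u | u \notin Y) h u ^+ 2 = (r ^+ 2) ^+ 2.
  have hw : h w = - r ^+ 2 by rewrite /h Nw (adj_irr G) /=; ring.
  by rewrite (bigD1 w) //= hw sqrrN => /(canRL (addKr _)); rewrite addNr.
pose c := q - r ^+ 2.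
transitivity (\sum_(u | u \notin Y) (c ^+ 2 * 1 + (r ^+ 2 - 2 * c * r) * a w u
   + deg (nbrs Y w) u ^+ 2 - 2 * c * deg (nbrs Y w) u
   + 2 * r * (a w u * deg (nbrs Y w) u))).
  by apply: eq_bigr => u _; rewrite /h -/c; case: (adj w u) => /=; ring.
rewrite !big_split /= sumrN -!mulr_sumr (sum_deg2 cY) // (sum_deg cY) //.
rewrite (card_outside cY) bq.
have -> : \sum_(u | u \notin Y) a w u = k%:R - q.
  apply: (addIr q); rewrite subrK -(sum_adj G w) [RHS](bigID (mem Y)) /= addrC.
  congr (_ + _); rewrite -(deg_out cY wY).
  by apply: eq_bigr => y _; rewrite (adj_sym G).
(* Each of the [q] vertices of [nbrs Y w] is adjacent to [w] and has [lam] common neighbours with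
   it, all outside [Y]. *)
have -> : \sum_(u | u \notin Y) a w u * deg (nbrs Y w) u = q * lam%:R.
  under eq_bigr => u _ do rewrite mulr_sumr.
  rewrite exchange_big /= -bq mulr_natl -sumr_const; apply: eq_bigr => y.
  rewrite inE => /andP[yY yw]; under eq_bigr => u _ do rewrite mulrC.
  rewrite (sum_outside _ cY) // (sum_adj2 G) yw.
  have /negbTE-> : y != w by apply: contraNneq wY => <-.
  by rewrite /=; ring.
rewrite /c v_def k_def mu_def lam_def m_def.
by field; rewrite r1_neq0.
Qed.

Lemma card_nbrsI (Y : {set V}) w z : #|nbrs Y w :&: nbrs Y z|%:R = deg (nbrs Y w) z.
Proof.
rewrite sum_indicator; congr (_%:R); apply: eq_card => y; rewrite !inE.
by case: (y \in Y); case: adj.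
Qed.

Lemma adj_notin Y x y : mc Y -> y \in Y -> adj x y -> x \notin Y.
Proof. by move=> cY yY; apply: contraTN => xY; rewrite (coclique_adj cY). Qed.

Lemma deg_diff Y Z y : mc Y -> mc Z -> y \in Y ->
  deg (Z :\: Y) y = if y \in Z then 0 else q.
Proof.
move=> cY cZ yY; case: ifP => [yZ|/negbT yZ]; first by rewrite (deg_in cZ) ?subsetDl.
rewrite -(deg_out cZ yZ) [RHS](big_setID Y) /= [X in _ = X + _]big1 ?add0r //.
by move=> z /setIP[_ zY]; rewrite (coclique_adj cY).
Qed.

(** Counts the edges between [nbrs Y w] and [Z :\: Y]: a vertex of [Y] has no neighbour in [Z] if it
    lies in [Z], and otherwise [q] of them, all outside [Y]. *)
Lemma sum_nbrsI Y Z w : mc Y -> mc Z ->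
  \sum_(z in Z :\: Y) deg (nbrs Y w) z = q * #|nbrs Y w :\: Z|%:R.
Proof.
move=> cY cZ; rewrite exchange_big /= (big_setID Z) /= big1 ?add0r.
  rewrite mulr_natr -sumr_const; apply: eq_bigr => y; rewrite !inE => /and3P[yZ yY _].
  have := deg_diff cY cZ yY; rewrite (negbTE yZ) => <-.
  by apply: eq_bigr => z _; rewrite (adj_sym G).
move=> y; rewrite !inE => /andP[/andP[yY _] yZ].
have := deg_diff cY cZ yY; rewrite yZ => e; rewrite -[RHS]e.
by apply: eq_bigr => z _; rewrite (adj_sym G).
Qed.

Lemma card_mcD Y Z : mc Y -> mc Z -> #|Z :\: Y| = #|Y :\: Z|.
Proof. by move=> cY cZ; rewrite !cardsD setIC (card_mc cY) (card_mc cZ). Qed.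

Lemma nbrs_disjoint Y Z z : mc Z -> z \in Z -> nbrs Y z :\: Z = nbrs Y z.
Proof.
move=> cZ zZ; apply/setDidPl/pred0P => y /=; apply/negbTE; rewrite inE negb_and.
rewrite -implybE; apply/implyP => /andP[_ yz]; exact: (adj_notin cZ zZ).
Qed.

(** For [z] in [Z :\: Y] the set [nbrs Y z] avoids [Z], so [sum_nbrsI] at [z] reads [(q - r ^+ 2) *
    #|Z :\: Y| + r ^+ 2 = q ^+ 2]. *)
Lemma card_mcD_eq Y Z : mc Y -> mc Z -> Y != Z ->
  #|Y :\: Z|%:R = (q ^+ 2 - r ^+ 2) / (q - r ^+ 2).
Proof.
move=> cY cZ ne.
have /set0Pn[z zZY] : Z :\: Y != set0.
  rewrite setD_eq0; apply: contraNN ne => ZY; rewrite eq_sym eqEcard ZY.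
  by rewrite (card_mc cY) (card_mc cZ) /=.
have [zZ zY] := setDP zZY.
have := sum_nbrsI z cY cZ; rewrite (nbrs_disjoint _ cZ zZ) card_nbrs (deg_out cY zY).
rewrite (eq_bigr (fun z' => q - r ^+ 2 + r ^+ 2 * (z == z')%:R)); last first.
  move=> z' /setDP[z'Z z'Y].
  by rewrite deg_nbrs // (coclique_adj cZ) // mulr0 subr0.
rewrite big_split /= sumr_const -mulr_sumr (bigD1 z) //= eqxx big1 => [|z']; last first.
  by case/andP => _; rewrite eq_sym => /negbTE->.
rewrite card_mcD // -[X in X + _]mulr_natr addr0 mulr1 => e.
by apply: (canRL (mulfK c_neq0)); rewrite mulrC [q ^+ 2]expr2 -e addrK.
Qed.

Lemma card_mcI_eq Y Z : mc Y -> mc Z -> Y != Z ->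
  #|Y :&: Z|%:R = (q - 1) * r / (q - r ^+ 2).
Proof.
move=> cY cZ ne; have := cardsID Z Y; rewrite (card_mc cY) => e.
have {}e : #|Y :&: Z|%:R = m%:R - #|Y :\: Z|%:R :> R by rewrite -e natrD addrK.
by rewrite e (card_mcD_eq cY cZ ne) m_def; by field.
Qed.

(** With [j] the unknown degree, [sum_nbrsI] at [w] becomes
    [q ^+ 2 - r ^+ 2 = (q + r) * (q - j)]. *)
Lemma deg_mcI Y Z w : mc Y -> mc Z -> Y != Z -> w \notin Y -> w \notin Z ->
  deg (Y :&: Z) w = r.
Proof.
move=> cY cZ ne wY wZ; set j := deg _ w.
have jZ : deg (Z :\: Y) w = q - j.
  by rewrite -(deg_out cZ wZ) [in RHS](big_setID Y) /= setIC addrAC subrr add0r.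
have jY : #|nbrs Y w :\: Z|%:R = q - j.
  rewrite -(deg_out cY wY) [in RHS](big_setID Z) /= addrAC subrr add0r.
  rewrite sum_indicator; congr (_%:R); apply: eq_card => y; rewrite !inE.
  by rewrite andbA.
have := sum_nbrsI w cY cZ; rewrite jY.
rewrite (eq_bigr (fun z => q - r ^+ 2 - r * a z w)); last first.
  move=> z /setDP[zZ zY]; rewrite deg_nbrs // (adj_sym G w).
  have /negbTE-> : w != z by apply: contraNneq wZ => ->.
  by rewrite mulr0 addr0.
rewrite big_split /= sumr_const sumrN -mulr_sumr jZ card_mcD // -[X in X - _]mulr_natr.
rewrite (card_mcD_eq cY cZ ne) mulrCA mulfV // mulr1 => e.
have qr : q + r != 0 by rewrite gt_eqF // addr_gt0 // (lt_trans ltr01).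
apply: (mulfI qr); apply/eqP; rewrite -subr_eq0; apply/eqP.
transitivity (q ^+ 2 - r ^+ 2 - r * (q - j) - q * (q - j)); first ring.
by rewrite e subrr.
Qed.

(** Counts the edges between [Y1 :&: Y2] and [W]: each vertex of [W] has [r] neighbours in
    [Y1 :&: Y2], and each vertex of [Y1 :&: Y2] outside [Y3] has all its [q] neighbours in [Y3]
    inside [W]. As [#|W|] is affine in [x], the equation determines [x]. *)
Lemma card_mcI3 Y1 Y2 Y3 : mc Y1 -> mc Y2 -> mc Y3 ->
  Y1 != Y2 -> Y1 != Y3 -> Y2 != Y3 ->
  #|Y1 :&: Y2 :&: Y3|%:R = (r ^+ 2 - r) / (q - r ^+ 2).
Proof.
move=> c1 c2 c3 n12 n13 n23; set x := #|_|.
pose i := #|Y1 :&: Y2|; pose W := Y3 :\: (Y1 :|: Y2).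
have cardW : #|W|%:R = m%:R - (#|Y1 :&: Y3|%:R + #|Y2 :&: Y3|%:R - x%:R) :> R.
  have := cardsID (Y1 :|: Y2) Y3; rewrite (card_mc c3) -/W => <-.
  rewrite natrD setIUr !(setIC Y3).
  have := cardsUI (Y1 :&: Y3) (Y2 :&: Y3).
  rewrite -setIIl -/x => /(congr1 (fun n => n%:R : R)); rewrite !natrD => <-.
  by rewrite addrK addrAC subrr add0r.
have e : r * #|W|%:R = q * (i%:R - x%:R).
  transitivity (\sum_(w in W) deg (Y1 :&: Y2) w).
    rewrite mulr_natr -sumr_const; apply: eq_bigr => w; rewrite !inE negb_or.
    by case/andP => /andP[w1 w2] _; rewrite deg_mcI.
  rewrite exchange_big /= (big_setID Y3) /= big1 ?add0r.
    have -> : i%:R - x%:R = #|(Y1 :&: Y2) :\: Y3|%:R :> R.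
      by rewrite /i -(cardsID Y3 (Y1 :&: Y2)) natrD addrAC subrr add0r.
    rewrite mulr_natr -sumr_const; apply: eq_bigr => y /setDP[/setIP[y1 y2] y3].
    rewrite -(deg_out c3 y3) [RHS](big_setID (Y1 :|: Y2)) /= [X in _ = X + _]big1 ?add0r.
      by apply: eq_bigr => w _; rewrite (adj_sym G).
    move=> w /setIP[_ /setUP[w1|w2]]; first by rewrite (coclique_adj c1).
    by rewrite (coclique_adj c2).
  move=> y /setIP[_ y3]; apply: big1 => w /setDP[w3 _].
  by rewrite (coclique_adj c3).
have qr : q + r != 0 by rewrite gt_eqF // addr_gt0 // (lt_trans ltr01).
apply: (mulfI qr); transitivity (q * i%:R - q * (i%:R - x%:R) + r * x%:R); first ring.
rewrite -e cardW /i (card_mcI_eq c1 c2) // (card_mcI_eq c1 c3) // (card_mcI_eq c2 c3) // m_def; by field.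
Qed.

Lemma nbrs_mc Y Z z : mc Z -> z \in Z -> nbrs Y z \subset Y :\: Z.
Proof. by move=> cZ zZ; rewrite -(nbrs_disjoint Y cZ zZ) setSD ?nbrs_sub. Qed.

(** Blocks through two points [y], [y'] correspond to the common neighbours of [y] and [y'] in [Z].
    So [deg_nbrs] applied to [Z] gives the design property, and applied to [Y] gives the block
    intersections. *)
Lemma nbrs_sym_design Y Z : mc Y -> mc Z -> Y != Z ->
  exists vt kt lt : nat,
    [/\ vt%:R = (q ^+ 2 - r ^+ 2) / (q - r ^+ 2), kt%:R = q, lt%:R = q - r ^+ 2 &
      sym_design2 (Y :\: Z) [set nbrs Y z | z in Z :\: Y] vt kt lt].
Proof.
move=> cY cZ ne.
have /set0Pn[z0 /setDP[z0Z z0Y]] : Z :\: Y != set0.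
  rewrite setD_eq0; apply: contraNN ne => ZY; rewrite eq_sym eqEcard ZY.
  by rewrite (card_mc cY) (card_mc cZ) /=.
have cI (Y' : {set V}) w z : mc Y' -> w \notin Y' -> z \notin Y' -> ~~ adj w z -> w != z ->
    #|nbrs Y' w :&: nbrs Y' z|%:R = q - r ^+ 2.
  move=> cY' wY zY /negbTE nwz /negbTE nz; rewrite card_nbrsI deg_nbrs // nwz nz.
  by rewrite !mulr0 addr0 subr0.
have nadj (Y' : {set V}) w z : mc Y' -> w \in Y' -> z \in Y' -> ~~ adj w z.
  by move=> cY' wY zY; rewrite (coclique_adj cY').
have cb z : z \notin Y -> #|nbrs Y z| = #|nbrs Y z0|.
  by move=> zY; apply/eqP; rewrite -(eqr_nat R) !card_nbrs !deg_out.
have inj : {in Z :\: Y &, injective (nbrs Y)}.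
  move=> z z' /setDP[zZ zY] /setDP[z'Z z'Y] e; apply/eqP; apply: contraT => nz.
  have := cI _ _ _ cY zY z'Y (nadj _ _ _ cZ zZ z'Z) nz.
  rewrite -e setIid card_nbrs deg_out // => /eqP.
  by rewrite eq_sym -subr_eq0 addrAC subrr add0r oppr_eq0 sqrf_eq0 gt_eqF.
(* [q - r ^+ 2] is a natural number because it counts common neighbours of two points; there are two
   points because a block already has [q > 1] of them. *)
have [l lE] : exists l : nat, l%:R = q - r ^+ 2.
  have q_nat : q = #|nbrs Y z0|%:R by rewrite card_nbrs deg_out.
  case: (leqP #|Y :\: Z| 1) => [le1|]; last first.
    case/card_gt1P => y [y' [/setDP[yY yZ] /setDP[y'Y y'Z] nyy]].
    by exists #|nbrs Z y :&: nbrs Z y'|; rewrite cI // (nadj Y).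
  have : #|nbrs Y z0|%:R <= 1 :> R.
    by rewrite (ler_nat _ _ 1) (leq_trans _ le1) // subset_leq_card // nbrs_mc.
  by rewrite -q_nat leNgt q_gt1.
exists #|Y :\: Z|, #|nbrs Y z0|, l; split=> //.
- exact: card_mcD_eq.
- by rewrite card_nbrs deg_out.
split; first split=> //.
- by move=> b /imsetP[z /setDP[zZ zY] ->]; rewrite nbrs_mc // cb.
- move=> y y' /setDP[yY yZ] /setDP[y'Y y'Z] nyy.
  apply/eqP; rewrite -(eqr_nat R) lE -(cI Z y y') ?(nadj Y) // eqr_nat.
  have -> : [set b in [set nbrs Y z | z in Z :\: Y] | (y \in b) && (y' \in b)]
     = nbrs Y @: (nbrs Z y :&: nbrs Z y').
    apply/setP => b; rewrite inE; apply/andP/imsetP.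
      case=> /imsetP[z /setDP[zZ zY] ->]; rewrite !inE => /andP[/andP[_ yz] /andP[_ y'z]].
      by exists z => //; rewrite !inE zZ (adj_sym G z) yz (adj_sym G z).
    case=> z; rewrite !inE => /andP[/andP[zZ zy] /andP[_ zy']] ->.
    rewrite imset_f ?inE ?zZ ?(adj_notin cY yY) //.
    by rewrite yY y'Y -!(adj_sym G z) zy zy'.
  apply/eqP/card_in_imset => z z' /setIP[zy _] /setIP[z'y _]; apply: inj.
    exact: (subsetP (nbrs_mc Z cY yY)).
  exact: (subsetP (nbrs_mc Z cY yY)).
exists l => b1 b2 /imsetP[z /setDP[zZ zY] ->] /imsetP[z' /setDP[z'Z z'Y] ->] nbb.
apply/eqP; rewrite -(eqr_nat R) lE cI ?(nadj Z) //.
by apply: contraNneq nbb => ->.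
Qed.

(** * Families of Delsarte cocliques *)

Let lt_r_q : r < q.
Proof.
have [r_le1|r_gt1] := lerP r 1; first exact: le_lt_trans q_gt1.
have : r < r ^+ 2 by rewrite expr2 ltr_pMl.
by move/lt_trans; apply; rewrite -subr_gt0.
Qed.

(** Settles the bound [m.+1] for families of at most two cocliques, and ensures that a family of
    size [m.+1] has three members. *)
Lemma m_gt1 : (1 < m)%N.
Proof.
rewrite -(ltr_nat R) m_def ltr_pdivlMr // -subr_gt0.
have -> : q ^+ 2 + q * r - r - r ^+ 2 - 1 * (q - r ^+ 2) = (q - 1) * (q + r) by ring.
by rewrite mulr_gt0 ?subr_gt0 // addr_gt0 // (lt_trans ltr01).
Qed.

Context {D : {set {set V}}}.
Hypothesis mcD : forall Y, Y \in D -> mc Y.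

(** Three members are needed to realize [i] and [x] as cardinalities. The inequality [x < i] holds
    as [i - x] equals [r * (q - r) / (q - r ^+ 2)]; it also makes traces of different members
    differ. *)
Lemma trace_system Y : (2 < #|D|)%N -> Y \in D -> exists i x : nat,
  [/\ i%:R = (q - 1) * r / (q - r ^+ 2), x%:R = (r ^+ 2 - r) / (q - r ^+ 2), (x < i)%N
    & let C := [set Y :&: Y' | Y' in D :\ Y] in
      [/\ {in D :\ Y &, injective (setI Y)},
        forall X, X \in C -> X \subset Y /\ #|X| = i &
        {in C &, forall X X', X != X' -> #|X :&: X'| = x}]].
Proof.
move=> /card_gt2P[Y1 [Y2 [Y3 [[D1 D2 D3] [n12 n23 n31]]]]] DY.
pose i := #|Y1 :&: Y2|; pose x := #|Y1 :&: Y2 :&: Y3|.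
have iE : i%:R = (q - 1) * r / (q - r ^+ 2) by rewrite card_mcI_eq ?mcD.
have xE : x%:R = (r ^+ 2 - r) / (q - r ^+ 2) by rewrite card_mcI3 ?mcD // eq_sym.
have xi : (x < i)%N.
  rewrite -(ltr_nat R) iE xE ltr_pM2r ?invr_gt0 // -subr_gt0.
  have -> : (q - 1) * r - (r ^+ 2 - r) = r * (q - r) by ring.
  by rewrite mulr_gt0 // subr_gt0.
have Ii Y' : Y' \in D :\ Y -> #|Y :&: Y'| = i.
  rewrite !inE => /andP[ne DY']; apply/eqP.
  by rewrite -(eqr_nat R) iE card_mcI_eq ?mcD // eq_sym.
have Ix Y' Y'' : Y' \in D :\ Y -> Y'' \in D :\ Y -> Y' != Y'' ->
    #|(Y :&: Y') :&: (Y :&: Y'')| = x.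
  rewrite !inE => /andP[n' D'] /andP[n'' D''] ne; apply/eqP.
  by rewrite setIACA setIid setIA -(eqr_nat R) xE card_mcI3 ?mcD // eq_sym.
exists i, x; split=> //; split.
- move=> Y' Y'' D' D'' e; apply/eqP; apply: contraTT xi => ne.
  by rewrite -(Ix _ _ D' D'' ne) e setIid Ii // ltnn.
- by move=> X /imsetP[Y' D' ->]; rewrite subsetIl Ii.
move=> X X' /imsetP[Y' D' ->] /imsetP[Y'' D'' ->] ne.
by apply: Ix => //; apply: contraNneq ne => ->.
Qed.

Lemma card_mc_family : (#|D| <= m.+1)%N.
Proof.
have [D2|D3] := leqP #|D| 2; first exact: leq_trans D2 (leqW m_gt1).
have /card_gt0P[Y DY] : (0 < #|D|)%N by rewrite (ltn_trans _ D3).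
have [i [x [_ _ xi [inj cC mC]]]] := trace_system D3 DY.
rewrite (cardsD1 Y) DY add1n ltnS -(card_in_imset inj) -(card_mc (mcD DY)).
exact: fisher xi cC mC.
Qed.

Lemma full_mc_family : #|D| = m.+1 ->
  (exists vt kt lt : nat, [/\ vt = m, kt%:R = (q - 1) * r / (q - r ^+ 2),
      lt%:R = (r ^+ 2 - r) / (q - r ^+ 2) &
      exists (n : nat) (B : {set {set 'I_n}}), sym_design2 [set: 'I_n] B vt kt lt]) /\
  forall p : V, #|[set Y in D | p \in Y]|%:R = 1 + (q - 1) * r / (q - r ^+ 2).
Proof.
move=> Dm; have D3 : (2 < #|D|)%N by rewrite Dm ltnS m_gt1.
have CY Y : Y \in D -> #|[set Y :&: Y' | Y' in D :\ Y]| = #|Y|.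
  move=> DY; have [i [x [_ _ _ [inj _ _]]]] := trace_system D3 DY.
  rewrite (card_in_imset inj) (card_mc (mcD DY)); apply/eqP.
  by rewrite -eqSS -Dm (cardsD1 Y D) DY add1n.
split.
  have /card_gt0P[Y DY] : (0 < #|D|)%N by rewrite Dm.
  have [i [x [iE xE xi [inj cC mC]]]] := trace_system D3 DY.
  exists m, i, x; split=> //; apply: (@sym_design2_ord _ Y [set Y :&: Y' | Y' in D :\ Y]).
  split; last by exists x => X X' XC X'C; apply: mC.
  split=> [|//|p p' pY p'Y ne]; first exact: card_mc (mcD DY).
  by rewrite (square_system_dual xi cC mC (CY Y DY)) // (negbTE ne).
have degY Y p : Y \in D -> p \in Y ->
    #|[set Y' in D | p \in Y']|%:R = 1 + (q - 1) * r / (q - r ^+ 2).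
  move=> DY pY; have [i [x [iE xE xi [inj cC mC]]]] := trace_system D3 DY.
  rewrite -iE nat1r; congr (_%:R); rewrite (cardsD1 Y) inE DY pY add1n; congr _.+1.
  have := square_system_dual xi cC mC (CY Y DY) p p pY pY; rewrite eqxx => <-.
  rewrite -(card_in_imset (f := setI Y)); last first.
    move=> Y' Y''; rewrite !inE => /and3P[n' D' _] /and3P[n'' D'' _].
    by apply: inj; rewrite !inE ?n' ?n''.
  apply: eq_card => X; rewrite [RHS]inE andbb; apply/imsetP/andP.
    case=> Y'; rewrite !inE => /and3P[n' D' pY'] ->; rewrite inE pY pY'.
    by rewrite imset_f // !inE n'.
  case=> /imsetP[Y' D' ->]; rewrite inE => /andP[_ pY'].
  by exists Y' => //; move: D'; rewrite !inE pY' => /andP[-> ->].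
(* It remains to see that every vertex is covered. Counting incidences, [m.+1 * m] is the constant
   of [degY] times [#|cover D|], and by the parameter formulas also that constant times [v]. *)
move=> p; suff /bigcupP[Y DY pY] : p \in cover D by apply: (degY Y).
suff -> : cover D = setT by rewrite inE.
apply/eqP; rewrite eqEcard subsetT cardsT.
have e1 : 1 + (q - 1) * r / (q - r ^+ 2) != 0.
  by rewrite gt_eqF // ltr_wpDr // mulr_ge0 ?invr_ge0 ?ltW // mulr_gt0 ?subr_gt0.
have Vv : #|V| = v by case: G.
suff e : #|V| = #|cover D| by rewrite e leqnn.
apply/eqP; rewrite -(eqr_nat R) Vv; apply/eqP/(mulfI e1).
transitivity (m.+1%:R * m%:R : R).
  have -> : m.+1%:R = m%:R + 1 :> R by rewrite -natr1.
  by rewrite v_def m_def; field; rewrite c_neq0.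
transitivity (\sum_(Y in D) \sum_(p in Y) (1 : R)).
  rewrite -Dm mulr_natl -sumr_const; apply: eq_bigr => Y DY.
  by rewrite sumr_const (card_mc (mcD DY)).
transitivity (\sum_(Y in D) \sum_(p in cover D) ((p \in Y)%:R : R)).
  apply: eq_bigr => Y DY; rewrite [RHS](big_setID Y) /= [X in _ = _ + X]big1; last first.
    by move=> z /setDP[_ /negbTE->].
  have /setIidPr -> : Y \subset cover D by apply: bigcup_sup.
  by rewrite addr0; apply: eq_bigr => z ->.
rewrite exchange_big /= mulr_natr -sumr_const; apply: eq_bigr => z /bigcupP[Y DY zY].
by rewrite sum_indicator (degY Y).
Qed.

Lemma coprime_mc_family (x y : int) :
  r = x%:~R -> q = y%:~R -> coprimez x y -> 1 < r -> (#|D| <= 2)%N.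
Proof.
move=> rx qy cxy r1; rewrite leqNgt; apply/negP => D3.
have /card_gt0P[Y DY] : (0 < #|D|)%N by rewrite (ltn_trans _ D3).
have [i [t [_ tE _ _]]] := trace_system D3 DY.
have {}tE : (t%:Z * (y - x ^+ 2) = (x - 1) * x)%R.
  apply: (@intr_inj R); rewrite !(rmorphM, rmorphB, rmorphXn) /= -rx -qy -pmulrn tE.
  by rewrite mulfVK //; ring.
(* Modulo [x] the number [y - x ^+ 2] is [y]. As it divides [(x - 1) * x] by [tE], it divides
   [x - 1]. *)
have cop : coprimez (y - x ^+ 2) x.
  move: cxy => /coprimezP[[u w] /= e]; apply/coprimezP; exists (w, u + w * x) => /=.
  by rewrite -e; ring.
have dvd : (y - x ^+ 2 %| x - 1)%Z.
  by rewrite -(Gauss_dvdzl _ cop) -tE dvdz_mull.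
have x1 : 0 < x - 1 by rewrite subr_gt0 -(ltr_int R) -rx.
have le_c : q - r ^+ 2 <= r - 1.
  rewrite rx qy -[1]/(1%:~R) -rmorphXn -!rmorphB /= ler_int.
  have c0 : 0 < y - x ^+ 2 by rewrite -(ltr_int R) rmorphB rmorphXn /= -rx -qy.
  move: dvd c0 x1; rewrite dvdzE.
  case: (y - x ^+ 2) => // c; case: (x - 1) => // d /= cd _ d0.
  by rewrite lez_nat dvdn_leq.
(* The right side is [(1 + r) * lam%:R]. By [le_c] it is at most [r + r ^+ 2 - 2 * q], which is
   below [r - r ^+ 2 < 0] since [q > r ^+ 2]. *)
have lam_ge0 : 0 <= q * (q - r ^+ 2) + (r - q) * (1 + r).
  have r1_ge0 : 0 <= 1 + r by rewrite addr_ge0 // ltW.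
  by have := mulr_ge0 (ler0n R lam) r1_ge0; rewrite lam_def -addrA mulrDl divfK.
have : 0 <= q * (r - 1 - (q - r ^+ 2)) by rewrite mulr_ge0 ?subr_ge0 // ltW // (lt_trans ltr01).
have : 0 < r * (r - 1) by rewrite mulr_gt0 // subr_gt0.
by have := c_gt0; nra.
Qed.
End Delsarte.

(** * Graph parameters as functions of the two eigenvalues *)

Lemma delsarte_params (R : realFieldType) (v k lam mu m : nat) (r q : R) :
  0 < v%:R :> R -> 0 < r -> r < k%:R -> 0 < q ->
  lam%:R - mu%:R = r - q -> mu%:R = k%:R - r * q ->
  (k%:R - r) * (k%:R + q) = v%:R * mu%:R ->
  m%:R * (r + q) = k%:R + r * (v%:R - 1) -> v%:R * q = m%:R * (q + k%:R) ->
  [/\ 0 < q - r ^+ 2, 1 < q,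
      k%:R = q * (q + r) / (1 + r),
      mu%:R = q * (q - r ^+ 2) / (1 + r) &
      [/\ lam%:R = q * (q - r ^+ 2) / (1 + r) + r - q,
      m%:R = (q ^+ 2 + q * r - r - r ^+ 2) / (q - r ^+ 2) &
      v%:R = m%:R * (q + 2 * r + 1) / (1 + r)]].
Proof.
move=> v0 r0 rk q0 hlam hmu hv hm hd.
have r1 : 0 < 1 + r by rewrite addr_gt0.
have r1n : 1 + r != 0 by rewrite gt_eqF.
have mu0 : 0 < mu%:R :> R.
  by rewrite -(pmulr_rgt0 _ v0) -hv mulr_gt0 ?subr_gt0 ?addr_gt0 // (lt_trans r0).
have hk1 : k%:R * (1 + r) = q * (q + r).
  (* In the combination below [m] cancels, and what remains is a multiple of [v]. *)
  apply: (mulfI (lt0r_neq0 v0)); apply/eqP; rewrite -subr_eq0; apply/eqP.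
  transitivity (- ((r + q) * (v%:R * q - m%:R * (q + k%:R))
    + (q + k%:R) * (m%:R * (r + q) - (k%:R + r * (v%:R - 1)))
    + ((k%:R - r) * (k%:R + q) - v%:R * (k%:R - r * q)))); first ring.
  by rewrite hm hd hv hmu !subrr; ring.
have hk : k%:R = q * (q + r) / (1 + r) by rewrite -hk1 mulfK.
have hmu' : mu%:R = q * (q - r ^+ 2) / (1 + r) by rewrite hmu hk; field.
have c0 : 0 < q - r ^+ 2.
  by move: mu0; rewrite hmu' pmulr_lgt0 ?invr_gt0 // pmulr_rgt0.
have cn : q - r ^+ 2 != 0 by rewrite gt_eqF.
have hv' : v%:R = m%:R * (q + 2 * r + 1) / (1 + r).
  apply: (mulIf (lt0r_neq0 q0)); by rewrite hd hk; field.
have hm' : m%:R = (q ^+ 2 + q * r - r - r ^+ 2) / (q - r ^+ 2).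
  apply: (canRL (mulfK cn)); apply/eqP; rewrite -subr_eq0; apply/eqP.
  transitivity ((1 + r) * (m%:R * (r + q) - (k%:R + r * (v%:R - 1)))).
    by rewrite hk hv'; field.
  by rewrite hm subrr mulr0.
split=> //.
  (* If [q <= 1], then [r ^+ 2 < q] forces [r < 1], so [r * q < 1]; but [r * q] is the positive
     integer [k - mu]. *)
  rewrite ltNge; apply/negP => q1.
  have r_lt1 : r < 1 by rewrite -(@expr_lt1 _ 2) ?ltW // -subr_gt0 (lt_le_trans c0) // lerD2r.
  have : (mu < k)%N by rewrite -(ltr_nat R) -subr_gt0 hmu opprB addrCA subrr addr0 mulr_gt0.
  rewrite -(ler_nat R) -natr1 hmu -subr_ge0.
  have -> : k%:R - (k%:R - r * q + 1) = r * q - 1 by ring.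
  by rewrite subr_ge0 leNgt (le_lt_trans _ r_lt1) // ler_piMr // ltW.
by split=> //; rewrite -hmu' -[LHS](subrK mu%:R) hlam; ring.
Qed.

Theorem theorem1p2 (R : rcfType) (V : finType) (adj : rel V)
  (v k lam mu : nat) (ep em : R) :
  srg adj v k lam mu ->
  primitive adj ->
  (forall x : R, eigenvalue (adjmx R adj) x =
                 [|| x == k%:R, x == ep | x == em]) ->
  ep < k%:R -> 0 < ep -> em < 0 ->
  let mm := \rank (eigenspace (adjmx R adj) em) in
  v%:R * em = mm%:R * (em - k%:R) ->
  let DC := [set Y : {set V} | delsarte adj k em Y] in
  (forall Y Z : {set V}, Y \in DC -> Z \in DC -> Y != Z ->
     [/\ (exists vt kt lt : nat,
            [/\ vt%:R = (ep ^+ 2 - em ^+ 2) / (ep ^+ 2 + em),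
                kt%:R = - em,
                lt%:R = - ep ^+ 2 - em &
                sym_design2 (Y :\: Z)
                  [set [set y in Y | adj y z] | z in Z :\: Y] vt kt lt]),
         #|Y :&: Z|%:R = mm%:R - (ep ^+ 2 - em ^+ 2) / (ep ^+ 2 + em)
         /\ #|Y :&: Z|%:R = (em + 1) * ep / (ep ^+ 2 + em) &
         forall w, w \notin Y -> w \notin Z ->
           #|[set y in Y | adj y w] :&: (Y :&: Z)|%:R = ep]) /\
  ((#|DC| <= mm.+1)%N /\
   ((#|DC| = mm.+1)%N ->
      (exists vt kt lt : nat,
         [/\ vt%:R = (ep ^+ 2 + ep * em + ep - em ^+ 2) / (ep ^+ 2 + em),
             kt%:R = (em + 1) * ep / (ep ^+ 2 + em),
             lt%:R = (- ep ^+ 2 + ep) / (ep ^+ 2 + em) &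
             exists (n : nat) (B : {set {set 'I_n}}),
               sym_design2 [set: 'I_n] B vt kt lt])
      /\ forall x : V,
           #|[set Y in DC | x \in Y]|%:R = 1 + (em + 1) * ep / (ep ^+ 2 + em))) /\
  (forall Y1 Y2 Y3 : {set V}, Y1 \in DC -> Y2 \in DC -> Y3 \in DC ->
     Y1 != Y2 -> Y1 != Y3 -> Y2 != Y3 ->
     #|Y1 :&: Y2 :&: Y3|%:R = (- ep ^+ 2 + ep) / (ep ^+ 2 + em)) /\
  (forall a b : int, ep = a%:~R -> em = b%:~R -> coprimez a b -> 1 < ep ->
     (#|DC| <= 2)%N).

Proof.
move=> G _ spec ltk ep0 em0 mm hd DC.
have [hlam hmu hv] := srg_params G spec ltk ep0 em0.
have hrank := rank_eigenspace G spec ltk ep0 em0.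
have Vv : #|V| = v by case: G.
have v0 : 0 < v%:R :> R by rewrite ltr0n -Vv (srg_inhabited spec).
pose q := - em; have emE : em = - q by rewrite opprK.
have q0 : 0 < q by rewrite oppr_gt0.
rewrite -/mm in hrank; clearbody mm.
have emk : em - k%:R != 0 by rewrite subr_eq0 lt_eqF // (lt_le_trans em0).
(* By [hd] the size prescribed for a Delsarte coclique simplifies to [mm]. *)
have DCP Y : Y \in DC -> maxcoclique (adj := adj) (m := mm) Y.
  by rewrite inE /delsarte Vv hd mulfK // eqr_nat.
rewrite {}emE in hlam hmu hv hrank hd emk *; clearbody q.
have [c0 q1 hk hmu' [hlam' hm hv']] : [/\ 0 < q - ep ^+ 2, 1 < q,
      k%:R = q * (q + ep) / (1 + ep),
      mu%:R = q * (q - ep ^+ 2) / (1 + ep) &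
      [/\ lam%:R = q * (q - ep ^+ 2) / (1 + ep) + ep - q,
      mm%:R = (q ^+ 2 + q * ep - ep - ep ^+ 2) / (q - ep ^+ 2) &
      v%:R = mm%:R * (q + 2 * ep + 1) / (1 + ep)]].
  apply: delsarte_params => //.
  - by rewrite hmu mulrN.
  - by rewrite -hv opprK.
  - by rewrite -hrank opprK.
  - by apply: oppr_inj; rewrite -mulrN hd; ring.
have F x : x / (ep ^+ 2 + - q) = - x / (q - ep ^+ 2).
  by rewrite -(opprB q) invrN mulrN mulNr.
have F1 : (ep ^+ 2 - (- q) ^+ 2) / (ep ^+ 2 + - q) = (q ^+ 2 - ep ^+ 2) / (q - ep ^+ 2).
  by rewrite F sqrrN opprB.
have F2 : (- q + 1) * ep / (ep ^+ 2 + - q) = (q - 1) * ep / (q - ep ^+ 2).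
  by rewrite F -mulNr opprD opprK.
have F3 : (- ep ^+ 2 + ep) / (ep ^+ 2 + - q) = (ep ^+ 2 - ep) / (q - ep ^+ 2).
  by rewrite F opprD opprK.
(* The number of points claimed in (d) is the multiplicity [mm] itself. *)
have F4 : (ep ^+ 2 + ep * - q + ep - (- q) ^+ 2) / (ep ^+ 2 + - q) = mm%:R.
  by rewrite F hm; congr (_ / _); ring.
rewrite F1 F2 F3 F4 opprK (addrC (- ep ^+ 2)).
have c_neq0 : q - ep ^+ 2 != 0 by rewrite gt_eqF.
split; [|split; [|split]].
- move=> Y Z /DCP cY /DCP cZ ne; split.
  + exact: (nbrs_sym_design G ep0 q1 c0 hk hmu' hlam' hm hv' cY cZ ne).
  + rewrite (card_mcI_eq G ep0 c0 hk hmu' hlam' hm hv' cY cZ ne); split=> //.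
    by rewrite hm; field.
  + move=> w wY wZ.
    rewrite -(deg_mcI G ep0 q1 c0 hk hmu' hlam' hm hv' cY cZ ne wY wZ).
    rewrite sum_indicator; congr (_%:R); apply: eq_card => y; rewrite !inE.
    by case: (y \in Y); case: (y \in Z); case: (adj y w).
- split; first exact: (card_mc_family G ep0 q1 c0 hk hmu' hlam' hm hv' DCP).
  move=> Dm.
  have [[vt [kt [lt [vtE ktE ltE B]]]] deg] :=
    full_mc_family G ep0 q1 c0 hk hmu' hlam' hm hv' DCP Dm.
  by split=> //; exists vt, kt, lt; rewrite vtE in B *.
- move=> Y1 Y2 Y3 /DCP c1 /DCP c2 /DCP c3.
  exact: (card_mcI3 G ep0 q1 c0 hk hmu' hlam' hm hv' c1 c2 c3).
move=> a b epa qb cab; apply: (coprime_mc_family G ep0 q1 c0 hk hmu' hlam' hm hv' DCP epa _ _).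
  by rewrite -[LHS]opprK qb -rmorphN.
by rewrite /coprimez gcdzN.
Qed.
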